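(* Let $r\in\mathbb{N}$, let $\overrightarrow{u}=(u_1,u_2,\ldots,u_r)\in\mathbb{R}^r$, let $x,y\in\mathbb{R}$, $w=x+iy$, and put $\overrightarrow{x}=(x+u_1,u_2,u_3,\ldots,u_r)$. Then for every integer $n\ge 0$, $$\mathcal{K}(n;w,\overrightarrow{u},r)=\sum_{j=0}^{\lfloor n/2\rfloor}(-1)^j\binom{n}{2j}y^{2j}H_{n-2j}(\overrightarrow{x},r)+i\sum_{j=0}^{\lfloor (n-1)/2\rfloor}(-1)^j\binom{n}{2j+1}y^{2j+1}H_{n-1-2j}(\overrightarrow{x},r).$$
   Context: For $r\in\mathbb{N}$ and $\overrightarrow{v}=(v_1,\ldots,v_r)\in\mathbb{R}^r$, the generalized Hermite–Kampé de Fériet polynomials $H_n(\overrightarrow{v},r)$ are defined by $$\exp\Big(\sum_{j=1}^r v_jt^j\Big)=\sum_{n=0}^\infty H_n(\overrightarrow{v},r)\frac{t^n}{n!}.$$ For $w=x+iy$ with $x,y\in\mathbb{R}$ and $\overrightarrow{u}=(u_1,\ldots,u_r)\in\mathbb{R}^r$, the polynomials $\mathcal{K}(n;w,\overrightarrow{u},r)$ are defined by $$\exp\Big(wt+\sum_{j=1}^r u_jt^j\Big)=\sum_{n=0}^\infty \mathcal{K}(n;w,\overrightarrow{u},r)\frac{t^n}{n!}.$$ Empty sums are $0$. *)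

(* Defs.v *)
(* Stdlib reals and Coquelicot (series, complex numbers C), with MathComp's
   ordinals, binomials and big operators for the finite index ranges. *)
From Stdlib Require Import Reals Lra Lia ClassicalEpsilon FunctionalExtensionality.
From mathcomp Require Import all_boot.
From Coquelicot Require Import Coquelicot.

Set Implicit Arguments.
Unset Strict Implicit.
Unset Printing Implicit Defensive.

Open Scope R_scope.

(* Coquelicot has no complex exponential; this is e^(a + ib) = e^a (cos b + i sin b). *)
Definition Cexp (z : C) : C :=
  (exp (Re z) * cos (Im z), exp (Re z) * sin (Im z)).

Definition is_egf (h : nat -> R) (f : R -> R) : Prop :=
  forall t : R, is_series (fun n => h n * (t ^ n / INR n`!)) (f t).

(* A real indeterminate t already determines the coefficients
   ([is_cegf_inj] below). *)
Definition is_cegf (k : nat -> C) (f : R -> C) : Prop :=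
  forall t : R,
    @is_series C_AbsRing C_NormedModule
      (fun n => k n * RtoC (t ^ n / INR n`!))%C (f t).

(* Ordinals start at 0, so [v j] stands for v_(j+1) in v = (v_1, ..., v_r). *)
Definition vpoly (r : nat) (v : 'I_r -> R) (t : R) : R :=
  \big[Rplus/0]_(j < r) (v j * t ^ j.+1).

(* [ring] on equalities typed by one of Coquelicot's structures over R *)
Ltac ringR := lazymatch goal with |- @eq _ ?a ?b => change (@eq R a b) end; ring.

Lemma factorialE n : n`! = Factorial.fact n.
Proof. by elim: n => // n IH; rewrite factS IH. Qed.

Lemma INR_fact_neq0 n : INR n`! <> 0.
Proof. rewrite factorialE; exact: INR_fact_neq_0. Qed.

Definition entire (a : nat -> R) (f : R -> R) : Prop :=
  forall t : R, is_pseries a t (f t).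

Lemma is_egfE h f : is_egf h f <-> entire (fun n => h n / INR n`!) f.
Proof.
split=> H t; have := H t.
- move=> Ht; apply/is_pseries_R; apply: is_series_ext Ht => n.
  by rewrite /Rdiv; ringR.
- move/is_pseries_R => Ht; apply: is_series_ext Ht => n.
  by rewrite /Rdiv; ringR.
Qed.

Lemma entire_egf a f : entire a f -> is_egf (fun n => a n * INR n`!) f.
Proof.
move=> H; apply/is_egfE => t; apply: is_pseries_ext (H t) => n /=.
by field; apply: INR_fact_neq0.
Qed.

Lemma entire_radius a f : entire a f -> CV_radius a = p_infty.
Proof.
move=> H; case E: (CV_radius a) => [r||] //; last first.
  by have := CV_radius_ge_0 a; rewrite E.
have r0 : 0 <= r by have := CV_radius_ge_0 a; rewrite E.
have lt : Rbar_lt (CV_radius a) (Rabs (r + 1)).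
  by rewrite E /= Rabs_pos_eq; lra.
case: (CV_disk_outside _ _ lt); apply: ex_series_lim_0.
by exists (f (r + 1)); apply/is_pseries_R; apply: H.
Qed.

Lemma entire_inj a b f : entire a f -> entire b f -> forall n, a n = b n.
Proof.
move=> Ha Hb n.
apply: PSeries_ext_recip; rewrite ?(entire_radius Ha) ?(entire_radius Hb) //.
apply: filter_forall => t.
by rewrite (is_pseries_unique _ _ _ (Ha t)) (is_pseries_unique _ _ _ (Hb t)).
Qed.

Lemma entire_mul a b f g : entire a f -> entire b g ->
  entire (PS_mult a b) (fun t => f t * g t).
Proof.
move=> Ha Hb t.
by apply: is_pseries_mult => //; rewrite ?(entire_radius Ha) ?(entire_radius Hb).
Qed.

Lemma entire_ext a f g : (forall t, f t = g t) -> entire a f -> entire a g.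
Proof. by move=> E H t; rewrite -E. Qed.

Lemma entire_const c : entire (fun n => if n is 0%N then c else 0) (fun=> c).
Proof.
move=> t; apply/is_pseries_R.
apply: (filterlim_ext (fun=> c)); last exact: filterlim_const.
elim=> [|n IH]; first by rewrite sum_O /=; ringR.
by rewrite sum_Sn -IH /plus /=; ringR.
Qed.

Lemma entire_scale c a f : entire a f ->
  entire (fun n => a n * c ^ n) (fun t => f (c * t)).
Proof.
move=> H t; apply/is_pseries_R; have /is_pseries_R := H (c * t).
by apply: is_series_ext => n; rewrite Rpow_mult_distr; ringR.
Qed.

Lemma entire_pow m a f : entire a f ->
  entire (fun k => if (m.+1 %| k)%N then a (k %/ m.+1)%N else 0)
         (fun t => f (t ^ m.+1)).
Proof.
move=> H t; apply/is_pseries_R; have /is_pseries_R Hs := H (t ^ m.+1).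
apply: (filterlim_ext
  (fun N => sum_n (fun n => a n * (t ^ m.+1) ^ n) (N %/ m.+1)%N)).
  elim=> [|N IH]; first by rewrite div0n !sum_O dvdn0 div0n /=.
  rewrite [RHS]sum_Sn -IH divnS //; case: ifP => dv; last first.
    by rewrite add0n Rmult_0_l; symmetry; exact: plus_zero_r.
  rewrite !dv !add1n sum_Sn -pow_mult; congr (plus _ (_ * t ^ _)).
  by rewrite -[RHS](divnK dv) divnS // dv add1n multE mulnC.
apply: (filterlim_comp _ _ _ (fun N => (N %/ m.+1)%N)); last exact: Hs.
move=> P [M HM]; exists (M * m.+1)%N => N /leP le; apply: HM; apply/leP.
by rewrite leq_divRL.
Qed.

Lemma entire_exp : entire (fun n => / INR (Factorial.fact n)) exp.
Proof. exact: is_exp_Reals. Qed.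

Lemma entire_cos : exists a, entire a cos.
Proof.
exists (fun k => if (2 %| k)%N then cos_n (k %/ 2)%N else 0).
have H t : is_pseries cos_n (t ^ 2) (cos t).
  apply/is_pseries_R; apply/is_series_Reals.
  have -> : t ^ 2 = t² by rewrite /Rsqr /=; ring.
  by rewrite /cos; case: (exist_cos _).
move=> t.
have -> : cos t = cos t + t * 0 by ring.
apply: is_pseries_odd_even.
  by apply: is_pseries_ext (H t) => n; rewrite multE dvdn_mulr // mulKn.
apply/is_pseries_R; apply: (is_series_ext (fun=> 0)) => [n|].
  rewrite multE plusE dvdn_addr ?dvdn_mulr //=; ringR.
apply: (filterlim_ext (fun=> 0)); last exact: filterlim_const.
elim=> [|n IH]; first by rewrite sum_O.
by rewrite sum_Sn -IH /plus /=; ringR.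
Qed.

Lemma entire_sin : exists a, entire a sin.
Proof.
exists (PS_incr_1 (fun k => if (2 %| k)%N then sin_n (k %/ 2)%N else 0)).
move=> t; rewrite /sin; case: (exist_sin _) => l Hl.
apply: is_pseries_incr_1.
have -> : l = l + t * 0 by ring.
apply: is_pseries_odd_even.
  apply: (is_pseries_ext sin_n) => [n|].
    by rewrite multE dvdn_mulr // mulKn.
  apply/is_pseries_R; apply/is_series_Reals.
  by have -> : t ^ 2 = t² by rewrite /Rsqr /=; ring.
apply/is_pseries_R; apply: (is_series_ext (fun=> 0)) => [n|].
  rewrite multE plusE dvdn_addr ?dvdn_mulr //=; ringR.
apply: (filterlim_ext (fun=> 0)); last exact: filterlim_const.
elim=> [|n IH]; first by rewrite sum_O.
by rewrite sum_Sn -IH /plus /=; ringR.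
Qed.

Lemma entire_exp_vpoly r (v : 'I_r -> R) :
  exists a, entire a (fun t => exp (vpoly v t)).
Proof.
rewrite /vpoly; elim: (index_enum _) => [|j s [a IH]].
  exists (fun n => if n is 0%N then exp 0 else 0).
  by move=> t; rewrite big_nil; apply: entire_const.
have Hj := @entire_pow j _ _ (@entire_scale (v j) _ _ entire_exp).
eexists; apply: entire_ext (entire_mul Hj IH) => t.
by rewrite big_cons exp_plus.
Qed.

Lemma is_egf_inj h1 h2 f : is_egf h1 f -> is_egf h2 f -> h1 = h2.
Proof.
move=> /is_egfE H1 /is_egfE H2; apply: functional_extensionality => n.
have E := entire_inj H1 H2 n; have n0 := @INR_fact_neq0 n.
by apply: (Rmult_eq_reg_r (/ INR n`!)) => //; apply: Rinv_neq_0_compat.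
Qed.

Lemma is_series_CE (c : nat -> C) (l : C) :
  @is_series C_AbsRing C_NormedModule c l <->
  is_series (fun n => Re (c n)) (Re l) /\ is_series (fun n => Im (c n)) (Im l).
Proof.
have SR N : Re (@sum_n C_AbelianMonoid c N) = sum_n (fun n => Re (c n)) N.
  by elim: N => [|N IH]; rewrite ?sum_O // !sum_Sn -IH.
have SI N : Im (@sum_n C_AbelianMonoid c N) = sum_n (fun n => Im (c n)) N.
  by elim: N => [|N IH]; rewrite ?sum_O // !sum_Sn -IH.
rewrite /is_series; split.
- move/filterlim_locally => H; split; apply/filterlim_locally => eps.
  + apply: filter_imp (H eps) => N [h _]; rewrite -SR; exact: h.
  + apply: filter_imp (H eps) => N [_ h]; rewrite -SI; exact: h.
- case=> /filterlim_locally HR /filterlim_locally HI.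
  apply/filterlim_locally => eps.
  apply: filter_imp (filter_and _ _ (HR eps) (HI eps)) => N [].
  by rewrite -SR -SI => h1 h2; split.
Qed.

Lemma is_cegfE k f : is_cegf k f <->
  is_egf (fun n => Re (k n)) (fun t => Re (f t)) /\
  is_egf (fun n => Im (k n)) (fun t => Im (f t)).
Proof.
split.
- move=> H; split=> t; have /is_series_CE [HR HI] := H t.
  + by apply: is_series_ext HR => n; rewrite /Re /=; ringR.
  + by apply: is_series_ext HI => n; rewrite /Im /=; ringR.
- case=> HR HI t; apply/is_series_CE; split.
  + by apply: is_series_ext (HR t) => n; rewrite /Re /=; ringR.
  + by apply: is_series_ext (HI t) => n; rewrite /Im /=; ringR.
Qed.

Lemma is_cegf_inj k1 k2 f : is_cegf k1 f -> is_cegf k2 f -> k1 = k2.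
Proof.
move=> /is_cegfE [R1 I1] /is_cegfE [R2 I2].
apply: functional_extensionality => n.
have := f_equal (fun h => h n) (is_egf_inj R1 R2).
have := f_equal (fun h => h n) (is_egf_inj I1 I2).
by case: (k1 n) (k2 n) => [a b] [c d]; rewrite /Re /Im /= => -> ->.
Qed.

Lemma hermite_exists r (v : 'I_r -> R) :
  exists! h, is_egf h (fun t => exp (vpoly v t)).
Proof.
have [a Ha] := entire_exp_vpoly v.
exists (fun n => a n * INR n`!); split; first exact: entire_egf.
by move=> h; apply: is_egf_inj; apply: entire_egf.
Qed.

Lemma calK_exists r (w : C) (u : 'I_r -> R) :
  exists! k, is_cegf k (fun t => Cexp (w * RtoC t + RtoC (vpoly u t)))%C.
Proof.
case: w => x y.
have [a Ha] := entire_exp_vpoly u.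
have [c Hc] := entire_cos.
have [s Hs] := entire_sin.
have He := entire_mul (@entire_scale x _ _ entire_exp) Ha.
have HR := entire_egf (entire_mul He (@entire_scale y _ _ Hc)).
have HI := entire_egf (entire_mul He (@entire_scale y _ _ Hs)).
pose k n : C := (PS_mult (PS_mult (fun n => / INR (Factorial.fact n) * x ^ n) a)
                    (fun n => c n * y ^ n) n * INR n`!,
             PS_mult (PS_mult (fun n => / INR (Factorial.fact n) * x ^ n) a)
                    (fun n => s n * y ^ n) n * INR n`!).
have Hk : is_cegf k (fun t => Cexp ((x, y) * RtoC t + RtoC (vpoly u t)))%C.
  apply/is_cegfE; split=> t.
  - have := HR t; rewrite -exp_plus /Cexp /Re /Im /=.
    have -> : x * t - y * 0 + vpoly u t = x * t + vpoly u t by ring.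
    by have -> : x * 0 + y * t + 0 = y * t by ring.
  - have := HI t; rewrite -exp_plus /Cexp /Re /Im /=.
    have -> : x * t - y * 0 + vpoly u t = x * t + vpoly u t by ring.
    by have -> : x * 0 + y * t + 0 = y * t by ring.
by exists k; split=> // k'; apply: is_cegf_inj.
Qed.

(* H_n(v, r) and K(n; w, u, r), with r read off the type of the vector: the
   unique coefficient sequences with the given exponential generating
   functions. *)

Definition hermiteKdF (n r : nat) (v : 'I_r -> R) : R :=
  proj1_sig (constructive_indefinite_description _ (hermite_exists v)) n.

Definition calK (n r : nat) (w : C) (u : 'I_r -> R) : C :=
  proj1_sig (constructive_indefinite_description _ (calK_exists w u)) n.

Lemma hermiteKdF_egf r (v : 'I_r -> R) :
  is_egf (fun n => hermiteKdF n v) (fun t => exp (vpoly v t)).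
Proof.
rewrite /hermiteKdF.
by case: (constructive_indefinite_description _ _) => h [].
Qed.

Lemma calK_egf r (w : C) (u : 'I_r -> R) :
  is_cegf (fun n => calK n w u)
          (fun t => Cexp (w * RtoC t + RtoC (vpoly u t)))%C.
Proof.
by rewrite /calK; case: (constructive_indefinite_description _ _) => k [].
Qed.

(* (x + u_1, u_2, ..., u_r) *)
Definition shift_fst (r : nat) (x : R) (u : 'I_r -> R) : 'I_r -> R :=
  fun j => if (j == 0 :> nat)%N then x + u j else u j.

(* Main.v *)
(* Splitting e^(wt + u(t)) into real and imaginary parts gives
   e^(P(t)) cos (y t) and e^(P(t)) sin (y t), where P(t) = x t + u(t) is the
   polynomial attached to (x + u_1, u_2, ..., u_r).  Multiplying exponential
   generating functions is binomial convolution, and the coefficients of cos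
   and sin vanish at odd, respectively even, indices. *)
Require Import Defs.
From Stdlib Require Import Reals.
From HB Require Import structures.
From mathcomp Require Import all_boot.
From Coquelicot Require Import Coquelicot.
Local Open Scope R_scope.

Lemma RplusA : associative Rplus.
Proof. by move=> a b c; rewrite Rplus_assoc. Qed.

(** Makes the bigop lemmas for monoid laws, such as [big_ord_recr] and [big1], available for sums of
    reals. *)
HB.instance Definition _ :=
  Monoid.isComLaw.Build R 0 Rplus RplusA Rplus_comm Rplus_0_l.

Lemma sum_f_R0_big (F : nat -> R) (n : nat) :
  sum_f_R0 F n = \big[Rplus/0]_(k < n.+1) F k.
Proof.
elim: n => [|n IH]; first by rewrite big_ord_recr big_ord0 /= Rplus_0_l.
by rewrite big_ord_recr /= IH.
Qed.

Lemma big_distrR (m : nat) (c : R) (F : 'I_m -> R) :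
  c * \big[Rplus/0]_(k < m) F k = \big[Rplus/0]_(k < m) (c * F k).
Proof. by apply: big_morph => [a b|]; ring. Qed.

(** Used to discard the parity class on which the coefficients of cos or sin vanish. The condition
    2j + 1 <= n amounts to [j < uphalf n]. *)
Lemma big_even_odd (F : nat -> R) (n : nat) :
  \big[Rplus/0]_(k < n.+1) F k =
  \big[Rplus/0]_(j < (n./2).+1) F (2 * j)%N
  + \big[Rplus/0]_(j < uphalf n) F (2 * j + 1)%N.
Proof.
elim: n => [|n IH]; first by rewrite !big_ord_recr !big_ord0 /= muln0; ring.
rewrite big_ord_recr IH /=.
(* For odd [n] the new index [n.+1] extends the even sum by one term; for even [n] it extends the
   odd sum. *)
case En: (odd n).
- have E : uphalf n = (n./2).+1 by rewrite uphalf_half En.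
  have -> : n.+1 = (2 * (n./2).+1)%N.
    by rewrite mul2n doubleS -{1}(odd_double_half n) En.
  by rewrite E [in RHS]big_ord_recr /=; ring.
- have E : uphalf n = n./2 by rewrite uphalf_half En.
  have -> : n.+1 = (2 * n./2 + 1)%N.
    by rewrite mul2n addn1 -{1}(odd_double_half n) En.
  by rewrite E [X in _ = _ + X]big_ord_recr /=; ring.
Qed.

Lemma INR_bin (n k : nat) : (k <= n)%N ->
  INR 'C(n, k) = INR n`! * / INR k`! * / INR (n - k)`!.
Proof.
move=> le; rewrite -(bin_fact le) -!multE !mult_INR.
by field; split; apply: INR_fact_neq0.
Qed.

(** This is the Cauchy product of the power series with coefficients h_k / k! and g_k / k!; the
    factor n! / (k! (n-k)!) is the binomial coefficient. *)
Lemma is_egf_mul (h g : nat -> R) (f1 f2 : R -> R) :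
  is_egf h f1 -> is_egf g f2 ->
  is_egf (fun n => \big[Rplus/0]_(k < n.+1)
                     (INR 'C(n, k) * h k * g (n - k)%N))
         (fun t => f1 t * f2 t).
Proof.
move=> /is_egfE H1 /is_egfE H2.
apply/is_egfE => t; apply: is_pseries_ext (@entire_mul _ _ _ _ H1 H2 t) => n.
rewrite /PS_mult sum_f_R0_big /Rdiv Rmult_comm big_distrR.
apply: (@eq_bigr R) => k _; rewrite INR_bin; last by rewrite -ltnS.
rewrite minusE; field; split; first exact: INR_fact_neq0.
by split; apply: INR_fact_neq0.
Qed.

Lemma is_egf_scale (c : R) (h : nat -> R) (f : R -> R) :
  is_egf h f -> is_egf (fun n => c ^ n * h n) (fun t => f (c * t)).
Proof.
move=> /is_egfE H; apply/is_egfE => t.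
apply: is_pseries_ext (@entire_scale c _ _ H t) => n.
by rewrite /Rdiv; ringR.
Qed.

Lemma is_pseries_zero (t : R) : is_pseries (fun=> 0) t 0.
Proof. by apply: is_pseries_ext (@entire_const 0 t) => -[]. Qed.

Lemma is_egf_cos :
  is_egf (fun n => if odd n then 0 else (-1) ^ n./2) cos.
Proof.
apply/is_egfE => t.
(* The form even part plus [t] times odd part, both series in t^2; here the odd part is the zero
   series. *)
have -> : cos t = cos t + t * 0 by ring.
apply: is_pseries_odd_even.
- apply: (is_pseries_ext cos_n) => [n|].
    by rewrite multE mul2n odd_double doubleK factorialE /cos_n multE mul2n.
  apply/is_pseries_R; apply/is_series_Reals.
  have -> : t ^ 2 = Rsqr t by rewrite /Rsqr /=; ring.
  by rewrite /cos; case: (exist_cos _).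
- apply: is_pseries_ext (is_pseries_zero _) => n.
  by rewrite multE plusE mul2n addn1 /= odd_double /Rdiv Rmult_0_l.
Qed.

Lemma is_egf_sin :
  is_egf (fun n => if odd n then (-1) ^ n./2 else 0) sin.
Proof.
apply/is_egfE => t; rewrite /sin; case: (exist_sin _) => l Hl.
(* By definition sin t = t * l, with [l] the sum of the series [sin_n] in t^2, so the even part is
   zero. *)
rewrite -[t * l]Rplus_0_l.
apply: is_pseries_odd_even.
- apply: is_pseries_ext (is_pseries_zero _) => n.
  by rewrite multE mul2n odd_double /Rdiv Rmult_0_l.
- apply: (is_pseries_ext sin_n) => [n|].
    rewrite multE plusE mul2n addn1 factorialE /sin_n multE plusE mul2n addn1.
    by rewrite [odd _]/= odd_double /= uphalf_double.
  apply/is_pseries_R; apply/is_series_Reals.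
  by have -> : t ^ 2 = Rsqr t by rewrite /Rsqr /=; ring.
Qed.

(** The term x t is absorbed by the linear coefficient u_1, which exists because [0 < r]. *)
Lemma vpoly_shift_fst (r : nat) (u : 'I_r -> R) (x t : R) : (0 < r)%N ->
  vpoly (shift_fst x u) t = x * t + vpoly u t.
Proof.
case: r u => // r u _; rewrite /vpoly !big_ord_recl /shift_fst /=.
ring.
Qed.

Lemma is_egf_cos_mul (h : nat -> R) (f : R -> R) (y : R) : is_egf h f ->
  is_egf (fun n => \big[Rplus/0]_(j < (n./2).+1)
            ((-1) ^ j * INR 'C(n, 2 * j) * y ^ (2 * j) * h (n - 2 * j)%N))
         (fun t => f t * cos (y * t)).
Proof.
(* With the cosine as first factor, the convolution index k is the exponent of y and [h] is taken at
   n - k. *)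
move=> hf t; have := is_egf_mul _ _ _ _ (is_egf_scale y _ _ is_egf_cos) hf t.
rewrite Rmult_comm; apply: is_series_ext => n; congr (_ * _).
rewrite (big_even_odd (fun k => INR 'C(n, k)
  * (y ^ k * (if odd k then 0 else (-1) ^ k./2)) * h (n - k)%N)).
rewrite [X in _ + X]big1 ?Rplus_0_r => [|j _].
  by apply: eq_bigr => j _; rewrite mul2n odd_double doubleK; ring.
by rewrite mul2n addn1 /= odd_double /=; ring.
Qed.

Lemma is_egf_sin_mul (h : nat -> R) (f : R -> R) (y : R) : is_egf h f ->
  is_egf (fun n => \big[Rplus/0]_(j < uphalf n)
            ((-1) ^ j * INR 'C(n, 2 * j + 1) * y ^ (2 * j + 1)
             * h (n - 1 - 2 * j)%N))
         (fun t => f t * sin (y * t)).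
Proof.
move=> hf t; have := is_egf_mul _ _ _ _ (is_egf_scale y _ _ is_egf_sin) hf t.
rewrite Rmult_comm; apply: is_series_ext => n; congr (_ * _).
rewrite (big_even_odd (fun k => INR 'C(n, k)
  * (y ^ k * (if odd k then (-1) ^ k./2 else 0)) * h (n - k)%N)).
rewrite big1 ?Rplus_0_l => [|j _].
  (* Identifies n - 1 - 2j with n - k for k = 2j + 1. *)
  apply: eq_bigr => j _; rewrite -subnDA [(1 + _)%N]addnC.
  by rewrite mul2n addn1 [odd _]/= odd_double /= uphalf_double; ring.
by rewrite mul2n odd_double; ring.
Qed.

(* The range [j < uphalf n] is 0 <= j <= floor((n-1)/2), empty for n = 0. *)
Theorem theorem3 (r : nat) (hr : (0 < r)%N) (u : 'I_r -> R) (x y : R) (n : nat) :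
  calK n (Cplus x (Cmult Ci y)) u =
  Cplus
    (\big[Rplus/0]_(j < (n./2).+1)
        ((-1) ^ j * INR 'C(n, 2 * j) * y ^ (2 * j)
         * hermiteKdF (n - 2 * j) (shift_fst x u)))
    (Cmult Ci
      (\big[Rplus/0]_(j < uphalf n)
        ((-1) ^ j * INR 'C(n, 2 * j + 1) * y ^ (2 * j + 1)
         * hermiteKdF (n - 1 - 2 * j) (shift_fst x u)))).
Proof.
have H := @hermiteKdF_egf _ (shift_fst x u).
pose A m := \big[Rplus/0]_(j < (m./2).+1)
  ((-1) ^ j * INR 'C(m, 2 * j) * y ^ (2 * j)
   * hermiteKdF (m - 2 * j) (shift_fst x u)).
pose B m := \big[Rplus/0]_(j < uphalf m)
  ((-1) ^ j * INR 'C(m, 2 * j + 1) * y ^ (2 * j + 1)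
   * hermiteKdF (m - 1 - 2 * j) (shift_fst x u)).
have -> : Cplus (A n) (Cmult Ci (B n)) = (A n, B n).
  by rewrite /Cplus /Cmult /Ci /RtoC /=; congr (_, _); ring.
pose k m : C := (A m, B m).
have Hk : is_cegf k (fun t =>
  Cexp (Cplus (Cmult (Cplus x (Cmult Ci y)) t) (vpoly u t))).
  (* The exponent wt + u(t) has real part x t + u(t) and imaginary part y t. *)
  apply/is_cegfE; split=> t.
  - have := is_egf_cos_mul _ _ y H t.
    rewrite vpoly_shift_fst // /Cexp /Re /Im /=.
    by congr (is_series _ (exp _ * cos _)); ring.
  - have := is_egf_sin_mul _ _ y H t.
    rewrite vpoly_shift_fst // /Cexp /Re /Im /=.
    by congr (is_series _ (exp _ * sin _)); ring.
(* Both sequences have the same generating function, so they agree at every index. *)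
exact: (f_equal (fun c => c n) (@is_cegf_inj _ _ _ (@calK_egf _ _ u) Hk)).
Qed.
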